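(* Let $k,m\ge 1$ be integers. Every $k$-connected graph $G$ with at least $2m$ vertices contains a $k$-removable $m$-matching if \[ \delta(G)\ \ge\ \begin{cases} \max\bigl\{k+\bigl\lceil\tfrac m2\bigr\rceil,\ 2m\bigr\} & \text{if } k\ge m,\\ k+m & \text{if } k<m. \end{cases} \]
   Context: All graphs are finite, undirected and simple. $\delta(G)$ denotes the minimum degree of $G$. A graph is $k$-connected if it has at least $k+1$ vertices and deleting any set of at most $k-1$ vertices leaves a connected graph. For $F\subseteq E(G)$, $G-F$ is the graph obtained from $G$ by deleting the edges in $F$ (keeping all vertices). A matching is a set of pairwise disjoint edges; an $m$-matching is a matching consisting of exactly $m$ edges. A matching $M$ of a $k$-connected graph $G$ is $k$-removable if $G-M$ is $k$-connected. *)

(* Defs.v *)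
(* A simple graph is a symmetric irreflexive relation e on a finType
   of vertices T; these two properties are hypotheses of the theorem. *)
From mathcomp Require Import all_boot.

Set Implicit Arguments.
Unset Strict Implicit.
Unset Printing Implicit Defensive.

Section Graphs.
Variable T : finType.
Implicit Types (e : rel T) (S : {set T}) (F M : {set {set T}}) (v : T).

Definition degree e v : nat := #|[set w | e v w]|.

(* Every degree in a simple graph is at most #|T|, so the initial value #|T|
   never affects the minimum when T is nonempty. *)
Definition min_degree e : nat := \big[minn/#|T|]_(v : T) degree e v.

Definition edges e : {set {set T}} :=
  [set [set p.1; p.2] | p : T * T & e p.1 p.2].

Definition del_edges e F : rel T :=
  fun x y => e x y && ([set x; y] \notin F).

Definition del_vertices e S : rel {x : T | x \notin S} :=
  fun x y => e (val x) (val y).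

Definition matching e M : bool := (M \subset edges e) && trivIset M.

End Graphs.

Definition connected (T : finType) (e : rel T) : Prop :=
  forall x y : T, connect e x y.

Definition k_connected (k : nat) (T : finType) (e : rel T) : Prop :=
  k.+1 <= #|T| /\
  forall S : {set T}, #|S| < k -> connected (@del_vertices T e S).

Definition k_removable (k : nat) (T : finType) (e : rel T)
    (M : {set {set T}}) : Prop :=
  k_connected k (del_edges e M).

(* Main.v *)
(* Call an edge ab of a k-connected graph critical if deleting it destroys
   k-connectivity; this is witnessed by a partition A, S, B of the vertices with
   #|S| < k whose only A-B edge is ab. Uncrossing two such separations at a
   vertex x of degree more than k gives Mader's strict decrease of side sizes.

   A removable matching M with fewer than m edges can always be enlarged.
   Suppose not, let J = G - M and let W be the set of uncovered vertices; then
   every edge inside W is critical in J.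
   - If m <= k, every vertex of W has two neighbours in W, so from a critical
     edge ab with a, b in W one passes forever to strictly smaller sides.
   - If k < m, trying to exchange xy in M for ux, vy shows that two vertices u, v
     of W send at most two noncritical edges to each edge of M, whence they are
     incident with more than 2k critical edges in total. But a minimal side of a
     critical edge spans no critical edge, so its vertices have at most k critical
     edges each, and two disjoint minimal sides have at least 2m vertices, two of
     which lie in W. *)
Require Import Defs.
From mathcomp Require Import all_boot.
From mathcomp Require Import zify.

Set Implicit Arguments.
Unset Strict Implicit.
Unset Printing Implicit Defensive.

(** * Separations and k-connectivity *)

Section Separations.
Variable T : finType.
Implicit Types (e : rel T) (A B C D N S : {set T}).

(** One sum encodes disjointness and covering together, so facts about sides reduce to Boolean cases
    at a single vertex. Classes may be empty. *)
Definition tripartition A S B : bool :=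
  [forall v, (v \in A) + (v \in S) + (v \in B) == 1].

Lemma tripartitionP A S B :
  reflect (forall v, (v \in A) + (v \in S) + (v \in B) = 1) (tripartition A S B).
Proof. exact: 'forall_eqP. Qed.

Lemma tripartitionC A S B : tripartition A S B -> tripartition B S A.
Proof. by move/tripartitionP => h; apply/tripartitionP => v; have := h v; lia. Qed.

Lemma tripartition_compl A S : [disjoint A & S] -> tripartition A S (~: (A :|: S)).
Proof.
move=> dAS; apply/tripartitionP => v; rewrite !inE.
case: (boolP (v \in A)) => [vA|_]; last by case: (v \in S).
by rewrite (disjointFr dAS vA).
Qed.

Definition linked e A B : bool := [exists x in A, exists y in B, e x y].

Lemma linkedP e A B :
  reflect (exists x y, [/\ x \in A, y \in B & e x y]) (linked e A B).
Proof.
apply: (iffP exists_inP) => [[x xA /exists_inP[y yB exy]]|[x [y [xA yB exy]]]].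
  by exists x, y; split.
by exists x => //; apply/exists_inP; exists y.
Qed.

(** A path-free, decidable form of connectivity, whose failure yields a concrete separation. *)
Definition k_connectedb k e : bool :=
  (k < #|T|) && [forall A, forall S, forall B,
    [&& tripartition A S B, #|S| < k, A != set0 & B != set0] ==> linked e A B].

Lemma k_connectedb_linked k e A S B x y :
    k_connectedb k e -> tripartition A S B -> #|S| < k -> x \in A -> y \in B ->
  linked e A B.
Proof.
case/andP=> _ /forallP/(_ A)/forallP/(_ S)/forallP/(_ B)/implyP h pt Sk xA yB.
apply: h; rewrite pt Sk /=; apply/andP; split; apply/set0Pn; [by exists x|by exists y].
Qed.

(** If [y] is unreachable from [x] outside [S], the set reached from [x] has no edge to the
    remaining vertices outside [S]. Conversely, a path from [A] to [B] avoiding [S] has to use an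
    edge between them. *)
Lemma k_connectedP k e : reflect (k_connected k e) (k_connectedb k e).
Proof.
apply: (iffP andP) => -[kT h]; split=> //.
  move=> S Sk x y; apply/negPn/negP => nxy.
  pose A := [set v | [exists z, (val z == v) && connect (del_vertices e (S:=S)) x z]].
  have dAS : [disjoint A & S].
    rewrite disjoint_subset; apply/subsetP => v; rewrite !inE.
    by case/existsP => z /andP[/eqP <- _]; exact: (valP z).
  have memA z : (val z \in A) = connect (del_vertices e (S:=S)) x z.
    rewrite inE; apply/existsP/idP => [[z' /andP[/eqP /val_inj -> //]]|xz].
    by exists z; rewrite eqxx.
  have xA : val x \in A by rewrite memA.
  have yB : val y \in ~: (A :|: S).
    by rewrite in_setC in_setU memA negb_or nxy (valP y).
  have /linkedP[p [q [pA]]] : linked e A (~: (A :|: S)).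
    apply: (k_connectedb_linked (k := k) _ _ Sk xA yB); first by rewrite /k_connectedb kT.
    exact: tripartition_compl.
   rewrite in_setC in_setU negb_or => /andP[qA qS] epq.
  move: pA qA; rewrite inE => /existsP[z /andP[/eqP zp xz]].
  have -> : q = val (Sub q qS : {x | x \notin S}) by [].
  rewrite memA => /negP; apply; apply: connect_trans xz (connect1 _).
  by rewrite /del_vertices /= zp.
apply/forallP => A; apply/forallP => S; apply/forallP => B; apply/implyP.
case/and4P => /tripartitionP part Sk /set0Pn[x xA] /set0Pn[y yB].
have xS : x \notin S by have := part x; rewrite xA; case: (x \in S).
have yS : y \notin S by have := part y; rewrite yB; case: (y \in S); lia.
have /connectP[p pth yl] := h S Sk (Sub x xS) (Sub y yS).
have [//|/linkedP nl] := boolP (linked e A B).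
have : val (last (Sub x xS : {x | x \notin S}) p) \in A.
  have : val (Sub x xS : {x | x \notin S}) \in A by [].
  elim: p (Sub x xS : {x | x \notin S}) pth {yl} => //= z p IH w /andP[ewz pth] wA.
  apply: IH pth _; apply: contraT => zA; case: nl; exists (val w), (val z); split=> //.
  have := part (val z); rewrite (negbTE zA) (negbTE (valP z)).
  by case: (val z \in B).
by rewrite -yl /= => yA; have := part y; rewrite yA yB; case: (y \in S).
Qed.

(* N need not be disjoint from C: the set being separated is C :\: N. *)
Lemma k_connected_sep k e C N x y :
    k_connectedb k e -> x \in C -> x \notin N -> y \notin C -> y \notin N ->
    (forall u v, u \in C -> u \notin N -> e u v -> (v \in C) || (v \in N)) ->
  k <= #|N|.
Proof.
move=> kc xC xN yC yN cl; rewrite leqNgt; apply/negP => Nk.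
have /linkedP[p [q []]] : linked e (C :\: N) (~: ((C :\: N) :|: N)).
  apply: (k_connectedb_linked (x := x) (y := y) kc _ Nk).
  - apply: tripartition_compl; rewrite disjoint_subset; apply/subsetP => v.
    by rewrite !inE => /andP[].
  - by rewrite !inE xC xN.
  by rewrite !inE (negbTE yC) (negbTE yN).
 rewrite !inE => /andP[pN pC] /norP[qC qN] /(cl _ _ pC pN).
by rewrite (negbTE qN) orbF => qC'; rewrite qC' qN in qC.
Qed.

Lemma not_k_connected_sep k e : k < #|T| -> ~~ k_connectedb k e ->
  exists A S B, [/\ tripartition A S B, #|S| < k, A != set0, B != set0 &
                    ~~ linked e A B].
Proof.
rewrite /k_connectedb => -> /=.
case/forallPn => A /forallPn[S /forallPn[B]]; rewrite negb_imply.
by case/andP=> /and4P[*]; exists A, S, B.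
Qed.


Lemma eq_k_connectedb k e1 e2 : e1 =2 e2 -> k_connectedb k e1 = k_connectedb k e2.
Proof.
move=> ee; congr (_ && _); apply: eq_forallb => A; apply: eq_forallb => S.
apply: eq_forallb => B; congr (_ ==> _); apply: eq_existsb => x.
by congr (_ && _); apply: eq_existsb => y; rewrite ee.
Qed.

(* Either C :\: N is {x}, and then N contains all but two neighbours of x, or
   x |: N separates the rest of C :\: N from y. *)
Lemma k_connected_sep2 k e C N x p q y :
    k_connectedb k e -> x \in C -> x \notin N -> y \notin C -> y \notin N ->
    irreflexive e -> k < degree e x ->
    (forall u v, u \in C -> u \notin N -> e u v -> v \notin C -> v \notin N ->
       u = x /\ (v = p \/ v = q)) ->
  k <= #|N|.+1.
Proof.
move=> kc xC xN yC yN e_irr dx cl.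
have [|hC] := boolP [exists z in C, (z != x) && (z \notin N)].
  case/exists_inP => z zC /andP[zx zN].
  have : k <= #|x |: N|.
    apply: (k_connected_sep (C := C) (x := z) (y := y) kc) => //.
    - by rewrite !inE negb_or zx.
    - by rewrite !inE negb_or yN andbT; apply: contraNneq yC => ->.
    move=> u v uC; rewrite !inE negb_or => /andP[ux uN] euv.
    apply: contraT; rewrite !negb_or => /andP[vC /andP[vx vN]].
    by have [uex _] := cl u v uC uN euv vC vN; rewrite uex eqxx in ux.
  by rewrite cardsU1 xN add1n.
have sub : [set w | e x w] \subset p |: (q |: N).
  apply/subsetP => w; rewrite !inE => exw.
  have [//|wN] := boolP (w \in N); first by rewrite !orbT.
  have [wC|wC] := boolP (w \in C).
    have [wx|wx] := eqVneq w x; first by rewrite wx e_irr in exw.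
    by case/exists_inP: hC; exists w => //; rewrite wx.
  by have [_ [] ->] := cl x w xC xN exw wC wN; rewrite eqxx ?orbT.
have := subset_leq_card sub; move: dx; rewrite !cardsU1 /degree; clear.
by do !case: (_ \notin _); lia.
Qed.

(** * Critical edges and the uncrossing of their separations *)

Lemma card_sum_mem A : #|A| = \sum_v (v \in A).
Proof. by rewrite -sum1_card big_mkcond; apply: eq_bigr => v _; case: (v \in A). Qed.

(* Certifies that deleting ab leaves a graph that is not k-connected. *)
Record critical_sep k e a b A S B : Prop := CriticalSep {
  cs_edge : e a b;
  cs_part : tripartition A S B;
  cs_small : #|S| < k;
  cs_inl : a \in A;
  cs_inr : b \in B;
  cs_only : forall u v, u \in A -> v \in B -> e u v -> u = a /\ v = b }.

Lemma critical_sepC k e a b A S B : symmetric e ->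
  critical_sep k e a b A S B -> critical_sep k e b a B S A.
Proof.
move=> es [eab pt Sk aA bB h]; split=> //; first by rewrite es.
  exact: tripartitionC.
by move=> u v uB vA; rewrite es => /(h _ _ vA uB)[].
Qed.

Lemma set2_eq (u v a b : T) :
  [set u; v] = [set a; b] -> u = a /\ v = b \/ u = b /\ v = a.
Proof.
move/setP=> h; move: (h u) (h v) (h a) (h b); rewrite !inE !eqxx ?orbT /=.
move/esym/orP => -[]/eqP-> /esym/orP[]/eqP->; rewrite ?eqxx ?orbb; auto.
  by move=> _ /eqP->; auto.
by move=> /eqP->; auto.
Qed.

(** Some [A] and [B] are linked before the deletion of [ab] but not after it, so [ab] is the only
    edge between them; the sides are swapped if [a] lies in [B]. *)
Lemma nonremovable_critical_sep k e a b : symmetric e -> k_connectedb k e ->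
    e a b -> ~~ k_connectedb k (del_edges e [set [set a; b]]) ->
  exists A S B, critical_sep k e a b A S B.
Proof.
move=> es kc eab nk; have kT : k < #|T| by case/andP: kc.
have [A [S [B [pt Sk A0 B0 nl]]]] := not_k_connected_sep kT nk.
case/set0Pn: A0 => x0 x0A; case/set0Pn: B0 => y0 y0B.
have [x [y [xA yB exy]]] := linkedP _ _ _ (k_connectedb_linked kc pt Sk x0A y0B).
have key u v : u \in A -> v \in B -> e u v -> [set u; v] = [set a; b].
  move=> uA vB euv; apply/eqP; apply: contraNT nl => ne; apply/linkedP.
  by exists u, v; split=> //; rewrite /del_edges euv inE.
have dAB v : v \in A -> v \in B -> False.
  by move=> vA vB; have := tripartitionP _ _ _ pt v; rewrite vA vB; case: (v \in S).
case: (set2_eq (key _ _ xA yB exy)) => -[xe ye]; subst x y.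
  exists A, S, B; split=> // u v uA vB euv.
  by case: (set2_eq (key _ _ uA vB euv)) => // -[ue _]; subst u; case: (dAB b).
exists B, S, A; split=> //; first exact: tripartitionC.
move=> u v uB vA; rewrite es => evu.
by case: (set2_eq (key _ _ vA uB evu)) => -[ue ve] //; subst u; case: (dAB b).
Qed.

(** Mader's uncrossing. [N1] and [N2] surround the corners [A :&: A'] and [B :&: B'], and their
    sizes add up to at most [2 * (k - 1)]. The degree of [x] forces [#|N1|] to be at least [k - 1],
    so [#|N2|] is below [k] and [B :&: B'] is empty. Then [B'] fits into [A :|: S] outside [N1]. *)
Lemma critical_sep_decr k e x y w A S B A' S' B' :
    symmetric e -> irreflexive e -> k_connectedb k e -> k < degree e x -> y != w ->
    critical_sep k e x y A S B -> critical_sep k e x w A' S' B' ->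
  #|B'| < #|A|.
Proof.
move=> es ei kc dx yw [exy pt Sk xA yB h] [exw pt' Sk' xA' wB' h'].
move/tripartitionP: pt => pt; move/tripartitionP: pt' => pt'.
pose N1 := (S :|: S') :\: (B :|: B'); pose N2 := (S :|: S') :\: (A :|: A').
have cards : #|N1| + #|N2| = #|S| + #|S'|.
  rewrite !card_sum_mem -!big_split; apply: eq_bigr => v _ /=.
  have := pt v; have := pt' v; rewrite !inE.
  by do !case: (v \in _).
have b1 : k <= #|N1|.+1.
  apply: (k_connected_sep2 (C := A :&: A') (x := x) (p := y) (q := w) (y := y) kc) => //.
  - by rewrite inE xA.
  - by have := pt x; have := pt' x; rewrite !inE xA xA'; do !case: (x \in _).
  - by have := pt y; rewrite !inE yB; do !case: (y \in _).
  - by rewrite !inE yB.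
  move=> u v; rewrite !inE => /andP[uA uA'] _ euv vA vN.
  have [vB|vB] := boolP (v \in B); first by have [] := h u v uA vB euv; auto.
  have [vB'|vB'] := boolP (v \in B'); first by have [] := h' u v uA' vB' euv; auto.
  by move: vA vN; have := pt v; have := pt' v; rewrite (negbTE vB) (negbTE vB');
     do !case: (v \in _).
(* Neither [y] nor [w] lies in [B :&: B']: otherwise [xy] and [xw] would cross the same separation
   and coincide. *)
have BB v : v \in B -> v \in B' -> False.
  move=> vB vB'.
  have : k <= #|N2|.
    apply: (k_connected_sep (C := B :&: B') (x := v) (y := x) kc).
    - by rewrite inE vB.
    - by have := pt v; have := pt' v; rewrite !inE vB vB'; do !case: (v \in _).
    - by have := pt x; rewrite !inE xA; do !case: (x \in _).
    - by rewrite !inE xA.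
    move=> p q; rewrite !inE => /andP[pB pB'] _; rewrite es => eqp.
    have [qA|qA] := boolP (q \in A).
      have [_ pe] := h q p qA pB eqp; subst p.
      have [_ /eqP] := h' x y xA' pB' exy; by rewrite (negbTE yw).
    have [qA'|qA'] := boolP (q \in A').
      have [_ pe] := h' q p qA' pB' eqp; subst p.
      have [_ /eqP] := h x w xA pB exw; by rewrite eq_sym (negbTE yw).
    by have := pt q; have := pt' q; rewrite (negbTE qA) (negbTE qA');
       do !case: (q \in _).
  by move: cards b1 Sk Sk'; clear; lia.
suff : #|B'| + #|N1| + 1 <= #|A| + #|S| by move: b1 Sk; clear; lia.
(* Strictness comes from [x], which lies in [A] but in neither [B'] nor [N1]. *)
have -> : 1 = \sum_v (v == x) by rewrite -(cards1 x) card_sum_mem; apply: eq_bigr => v _; rewrite inE.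
rewrite !card_sum_mem -!big_split; apply: leq_sum => v _ /=.
have := pt v; have := pt' v; have := BB v; rewrite !inE.
case: eqP => [->|_]; first by rewrite xA xA'; do !case: (x \in _).
by do !case: (v \in _) => //; case.
Qed.

(* The corner B :&: B' being nonempty, submodularity makes the corner A :&: A',
   or A :&: A' minus w, a side of wz or of ab. *)
Lemma critical_sep_inner k e a b A S B w z A' S' B' :
    symmetric e -> irreflexive e -> k_connectedb k e -> k < degree e w ->
    critical_sep k e a b A S B -> critical_sep k e w z A' S' B' ->
    w \in A -> z \in A -> B :&: B' != set0 ->
  exists p q C N D, critical_sep k e p q C N D /\ C \proper A.
Proof.
move=> es ei kc dw [eab pt Sk aA bB h] [ewz pt' Sk' wA' zB' h'] wA zA.
case/set0Pn => v0; rewrite inE => /andP[v0B v0B'].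
move/tripartitionP: pt => pt; move/tripartitionP: pt' => pt'.
pose N1 := (S :|: S') :\: (B :|: B'); pose N2 := (S :|: S') :\: (A :|: A').
have cards : #|N1| + #|N2| = #|S| + #|S'|.
  rewrite !card_sum_mem -!big_split; apply: eq_bigr => v _ /=.
  have := pt v; have := pt' v; rewrite !inE.
  by do !case: (v \in _).
have out1 u v : u \in A -> u \in A' -> e u v -> ~~ ((v \in A) && (v \in A')) ->
    v \notin N1 -> u = a /\ v = b \/ u = w /\ v = z.
  move=> uA uA' euv vA vN.
  have [vB|vB] := boolP (v \in B); first by left; apply: h.
  have [vB'|vB'] := boolP (v \in B'); first by right; apply: h'.
  by move: vA vN; have := pt v; have := pt' v; rewrite !inE (negbTE vB) (negbTE vB');
     do !case: (v \in _).
have wN1 : w \notin N1.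
  by have := pt w; have := pt' w; rewrite !inE wA wA'; do !case: (w \in _).
have zN1 : z \notin N1 by rewrite !inE zB' orbT.
have zA' : z \notin A' by have := pt' z; rewrite zB'; do !case: (z \in _).
have bA : b \notin A by have := pt b; rewrite bB; do !case: (b \in _).
have zb : z != b by apply: contraNneq bA => <-.
have bN1 : b \notin N1 by rewrite !inE bB.
(* The edge [zw] cannot leave [B :&: B'], since [z] lies in [A]. *)
have out2 u v : u \in B -> u \in B' -> e u v -> v \in B :&: B' \/ v \in N2 \/ u = b /\ v = a.
  move=> uB uB'; rewrite es => evu.
  have [vA|vA] := boolP (v \in A); first by have [] := h v u vA uB evu; auto.
  have [vA'|vA'] := boolP (v \in A').
    have [_ ue] := h' v u vA' uB' evu; subst u.
    by have := pt z; rewrite zA uB; case: (z \in S).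
  by have := pt v; have := pt' v; rewrite !inE (negbTE vA) (negbTE vA');
     do !case: (v \in _); auto.
have wN2 : w \notin N2 by rewrite !inE wA.
have wB : w \notin B by have := pt w; rewrite wA; do !case: (w \in _).
have v0N2 : v0 \notin N2.
  by have := pt v0; have := pt' v0; rewrite !inE v0B v0B'; do !case: (v0 \in _).
(* If [b] is in [B'], then [a] is outside [A'], and only [wz] leaves [A :&: A'] without entering
   [N1]. Adding [a] to [N2] blocks [ba], so [#|N2|] is at least [k - 1] and [#|N1|] is below [k]. *)
have [bB'|bB'] := boolP (b \in B').
  have aA' : a \notin A'.
    apply/negP => aA'; have [_ be] := h' a b aA' bB' eab.
    by rewrite be eqxx in zb.
  have wa : w != a by apply: contraNneq aA' => <-.
  have : k <= #|a |: N2|.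
    apply: (k_connected_sep (C := B :&: B') (x := v0) (y := w) kc).
    - by rewrite inE v0B.
    - rewrite in_setU1 negb_or v0N2 andbT; apply: contraTneq v0B => ->.
      by have := pt a; rewrite aA; do !case: (a \in _).
    - by rewrite inE (negbTE wB).
    - by rewrite in_setU1 negb_or wa wN2.
    move=> p q; rewrite in_setI => /andP[pB pB'] _ epq.
    by case: (out2 p q pB pB' epq) => [->//|[qN|[_ ->]]]; rewrite in_setU1 ?qN ?eqxx ?orbT.
  move=> kN; have {kN} Nk : #|N1| < k by move: kN Sk Sk' cards; rewrite cardsU1; clear; case: (_ \notin _); lia.
  exists w, z, (A :&: A'), N1, (~: ((A :&: A') :|: N1)); split; last first.
    apply/properP; split; first exact: subsetIl.
    by exists z; rewrite // inE zA.
  split=> //.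
  - apply: tripartition_compl; rewrite disjoint_subset; apply/subsetP => v.
    by have := pt v; have := pt' v; rewrite !inE; do !case: (v \in _).
  - by rewrite inE wA.
  - by rewrite in_setC in_setU negb_or zN1 inE zA (negbTE zA').
  move=> u v; rewrite in_setI => /andP[uA uA'].
  rewrite in_setC in_setU negb_or in_setI => /andP[vA vN] euv.
  case: (out1 u v uA uA' euv vA vN) => // -[ue _].
  by rewrite ue (negbTE aA') in uA'.
(* With [b] outside [B'], [N2] separates by itself, which leaves room for one more vertex in
   [N1]. *)
have : k <= #|N2|.
  apply: (k_connected_sep (C := B :&: B') (x := v0) (y := w) kc) => //.
  - by rewrite inE v0B.
  - by rewrite inE (negbTE wB).
  move=> p q; rewrite in_setI => /andP[pB pB'] _ epq.
  case: (out2 p q pB pB' epq) => [->//|[->|[pe _]]]; first by rewrite orbT.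
  by rewrite -pe pB' in bB'.
move=> kN2; have {kN2} Nk : #|N1|.+1 < k by move: kN2 Sk Sk' cards; clear; lia.
(* Moving [w] from the side into the separator disposes of [wz], and [ab] becomes the only crossing
   edge. *)
have [/andP[aA' aw]|aw] := boolP ((a \in A') && (a != w)).
  exists a, b, ((A :&: A') :\ w), (w |: N1), (~: (((A :&: A') :\ w) :|: (w |: N1))).
  split; last first.
    apply/properP; split; first by rewrite subDset subsetU // subsetIl orbT.
    by exists w; rewrite // !inE eqxx.
  split=> //.
  - apply: tripartition_compl; rewrite disjoint_subset; apply/subsetP => v.
    by have := pt v; have := pt' v; rewrite !inE; case: (v == w); do !case: (v \in _).
  - by rewrite cardsU1; move: Nk; clear; case: (_ \notin _); lia.
  - by rewrite !inE aw aA.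
  - rewrite in_setC in_setU in_setU1 negb_or negb_or bN1 andbT.
    rewrite in_setD1 in_setI (negbTE bA) andbF /=.
    by apply: contraNneq bA => ->.
  move=> u v; rewrite in_setD1 in_setI => /andP[uw /andP[uA uA']].
  rewrite in_setC !in_setU in_setD1 in_setI in_set1 => vv euv.
  have [vw vN vA] : [/\ v != w, v \notin N1 & ~~ ((v \in A) && (v \in A'))].
    by move: vv; case: (v == w) => //=; rewrite negb_or => /andP[].
  case: (out1 u v uA uA' euv vA vN) => // -[ue _].
  by rewrite ue eqxx in uw.
(* Every edge leaving the corner outside [N1] now starts at [w], so the degree of [w] contradicts
   the size of [N1]. *)
have : k <= #|N1|.+1.
  apply: (k_connected_sep2 (C := A :&: A') (x := w) (p := z) (q := b) (y := z) kc) => //.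
  - by rewrite inE wA.
  - by rewrite inE zA (negbTE zA').
  move=> u v; rewrite !in_setI => /andP[uA uA'] _ euv vA vN.
  case: (out1 u v uA uA' euv vA vN) => -[ue ve]; last by auto.
  subst u; move: aw; rewrite uA' negbK => /eqP aw.
  by split; [|right].
by rewrite leqNgt Nk.
Qed.
End Separations.

(** * Matchings and the deletion of their edges *)

Section Matchings.
Variables (T : finType) (e : rel T).
Hypotheses (e_sym : symmetric e) (e_irr : irreflexive e).
Implicit Types (a b u v w x y z : T) (A B S P : {set T}) (M : {set {set T}}).

Lemma edgesP P : reflect (exists x y, e x y /\ P = [set x; y]) (P \in edges e).
Proof.
apply: (iffP imsetP) => [[[x y]]|[x [y [exy ->]]]].
  by rewrite inE /= => exy ->; exists x, y.
by exists (x, y); rewrite ?inE.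
Qed.

Lemma edge_neq x y : e x y -> x != y.
Proof. by apply: contraTneq => ->; rewrite e_irr. Qed.

Lemma mem_cover2 M x y : [set x; y] \in M -> (x \in cover M) && (y \in cover M).
Proof.
by move=> xyM; apply/andP; split; apply/bigcupP; exists [set x; y];
   rewrite ?inE ?eqxx ?orbT.
Qed.

Lemma card_edge P : P \in edges e -> #|P| = 2.
Proof. by case/edgesP => x [y [/edge_neq xy ->]]; rewrite cards2 xy. Qed.

Lemma card_cover_matching M : matching e M -> #|cover M| = 2 * #|M|.
Proof.
case/andP => /subsetP sM /eqP <-; rewrite mulnC -sum_nat_const.
by apply: eq_bigr => P /sM /card_edge.
Qed.

Lemma matching_add M u x : matching e M -> e u x ->
    u \notin cover M -> x \notin cover M ->
  matching e ([set u; x] |: M) /\ #|[set u; x] |: M| = #|M|.+1.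
Proof.
case/andP => sM tM eux uM xM.
have dj P : P \in M -> [disjoint [set u; x] & P].
  move=> PM; rewrite disjoint_subset; apply/subsetP => z; rewrite !inE.
  case/orP => /eqP ->; [apply: contra uM|apply: contra xM] => zP;
    by apply/bigcupP; exists P.
have n0 : set0 \notin M.
  by apply/negP => /(subsetP sM) /card_edge; rewrite cards0.
have [tM' uxM] := trivIsetU1 dj tM n0.
rewrite cardsU1 uxM add1n; split=> //; apply/andP; split=> //.
by rewrite subUset sub1set sM andbT; apply/edgesP; exists u, x.
Qed.

(** Augmentation along the path [u], [x], [y], [v]: one edge is given up for two. *)
Lemma matching_swap M x y u v : matching e M -> [set x; y] \in M -> e x y ->
    e u x -> e v y -> u != v -> u \notin cover M -> v \notin cover M ->
  let M' := [set u; x] |: ([set v; y] |: (M :\ [set x; y])) in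
  matching e M' /\ #|M'| = #|M|.+1.
Proof.
move=> mM PM exy eux evy uv uM vM M'.
have [xM yM] := andP (mem_cover2 PM).
have [sM tM] := andP mM.
have m0 : matching e (M :\ [set x; y]).
  by apply/andP; split; [exact: subset_trans (subD1set _ _) sM|
     apply: trivIsetS tM; exact: subD1set].
have sc z : z \in cover (M :\ [set x; y]) -> z \in cover M.
  case/bigcupP => Q; rewrite !inE => /andP[_ QM] zQ; by apply/bigcupP; exists Q.
have nc z : z \in [set x; y] -> z \notin cover (M :\ [set x; y]).
  move=> zP; apply/bigcupP => -[Q]; rewrite !inE => /andP[QP QM] zQ.
  have := trivIsetP tM _ _ QM PM QP => /disjoint_setI0/setP/(_ z).
  by rewrite !inE zQ; move: zP; rewrite !inE => ->.
have [m1 c1] : matching e ([set v; y] |: (M :\ [set x; y])) /\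
    #|[set v; y] |: (M :\ [set x; y])| = #|M :\ [set x; y]|.+1.
  by apply: matching_add => //; [apply: contra vM => /sc|apply: nc; rewrite !inE eqxx orbT].
have cov z : z \in cover ([set v; y] |: (M :\ [set x; y])) ->
    [|| z == v, z == y | z \in cover (M :\ [set x; y])].
  rewrite /cover bigcup_setU big_set1 !inE -orbA //.
have [m2 c2] : matching e M' /\ #|M'| = #|[set v; y] |: (M :\ [set x; y])|.+1.
  apply: matching_add => //; apply/negP => /cov /or3P[/eqP h|/eqP h|h].
  - by rewrite h eqxx in uv.
  - by rewrite h yM in uM.
  - by rewrite sc in uM.
  - by rewrite -h xM in vM.
  - by rewrite h e_irr in exy.
  by move: h; apply/negP; apply: nc; rewrite !inE eqxx.
by split=> //; rewrite c2 c1 (cardsD1 [set x; y] M) PM.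
Qed.

Lemma card_trivIset_setI M A :
  trivIset M -> A \subset cover M -> #|A| = \sum_(P in M) #|A :&: P|.
Proof.
move=> tM sA; have -> : #|A| = \sum_(z in cover M) (z \in A).
  rewrite -sum1_card [LHS]big_mkcond [RHS]big_mkcond; apply: eq_bigr => z _.
  by case: (boolP (z \in A)) => [/(subsetP sA) ->|_] //; case: ifP.
rewrite big_trivIset //; apply: eq_bigr => P _.
rewrite -sum1_card [LHS]big_mkcond [RHS]big_mkcond; apply: eq_bigr => z _.
by rewrite inE; case: (z \in A); case: (z \in P).
Qed.

Lemma del_edges_sym M : symmetric (del_edges e M).
Proof. by move=> x y; rewrite /del_edges e_sym setUC. Qed.

Lemma del_edges_irr M : irreflexive (del_edges e M).
Proof. by move=> x; rewrite /del_edges e_irr. Qed.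

Lemma del_edges1 M P : del_edges (del_edges e M) [set P] =2 del_edges e (P |: M).
Proof. by move=> x y; rewrite /del_edges !inE negb_or -andbA [in RHS](andbC (_ != _)). Qed.

Lemma del_edges_uncovered M u x : u \notin cover M -> del_edges e M u x = e u x.
Proof.
move=> uM; rewrite /del_edges; case: (boolP (_ \in M)) => [/mem_cover2/andP[uc _]|_].
  by rewrite uc in uM.
by rewrite andbT.
Qed.

Lemma degree_uncovered M u : u \notin cover M -> degree (del_edges e M) u = degree e u.
Proof. by move=> uM; apply: eq_card => x; rewrite !inE del_edges_uncovered. Qed.

(** The edges of [M] being disjoint, at most one contains [u], and its other end is the only
    neighbour lost. *)
Lemma degree_del_matching M u :
  matching e M -> degree e u <= (degree (del_edges e M) u).+1.
Proof.
move=> mM; have [uM|uM] := boolP (u \in cover M); last by rewrite degree_uncovered.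
have [sM tM] := andP mM; case/bigcupP: uM => P PM uP.
have cP : #|P :\ u| = 1.
  by have := card_edge (subsetP sM _ PM); rewrite (cardsD1 u) uP add1n => -[].
rewrite -addn1 -cP; apply: leq_trans (leq_card_setU _ _).
apply: subset_leq_card; apply/subsetP => w; rewrite !inE /del_edges => euw.
rewrite euw /=; case: (boolP (_ \in M)) => //= uwM.
rewrite eq_sym (edge_neq euw) /=.
have [<-|nP] := eqVneq [set u; w] P; first by rewrite !inE eqxx orbT.
have := trivIsetP tM _ _ uwM PM nP => /disjoint_setI0/setP/(_ u).
by rewrite !inE eqxx uP.
Qed.

(** * Removable matchings that cannot be enlarged *)

Section Maximal.
Variables (k : nat) (M : {set {set T}}).
Hypotheses (mM : matching e M) (kM : k_connectedb k (del_edges e M)).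
(** [M'] ranges beyond the supersets of [M], so that exchanges are excluded as well as additions. *)
Hypothesis M_max : forall M', matching e M' -> #|M'| = #|M|.+1 ->
  ~~ k_connectedb k (del_edges e M').

Local Notation J := (del_edges e M).

Definition removable u x := k_connectedb k (del_edges J [set [set u; x]]).
(** Locking keeps this set and the next opaque to simplification; membership is opened only by
    [in_critical_nbrs] and [in_removable_nbrs]. *)
Definition critical_nbrs : T -> {set T} :=
  locked (fun u => [set x | J u x & ~~ removable u x]).
Definition removable_nbrs : T -> {set T} :=
  locked (fun u => [set x | J u x & removable u x]).

Lemma removableE u x :
  removable u x = k_connectedb k (del_edges J [set [set u; x]]).
Proof. by []. Qed.

Lemma in_critical_nbrs u x : (x \in critical_nbrs u) = J u x && ~~ removable u x.
Proof. by rewrite /critical_nbrs -lock inE. Qed.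

Lemma in_removable_nbrs u x : (x \in removable_nbrs u) = J u x && removable u x.
Proof. by rewrite /removable_nbrs -lock inE. Qed.

Lemma uncovered_critical u x : u \notin cover M -> x \notin cover M -> e u x ->
  ~~ removable u x.
Proof.
move=> uM xM eux; have [m1 c1] := matching_add mM eux uM xM.
by have := M_max m1 c1; rewrite removableE (eq_k_connectedb _ (del_edges1 M [set u; x])).
Qed.

(* If a separation defeats the exchange of xy for ux, vy, then ux and vy are
   its only crossing edges, so x, y are on one side and vx crosses as well. *)
Lemma no_swap (x y u v : T) : [set x; y] \in M -> e x y -> u != v ->
    u \notin cover M -> v \notin cover M ->
    x \in removable_nbrs u -> x \in removable_nbrs v -> y \in removable_nbrs v ->
  False.
Proof.
move=> PM exy uv uM vM; rewrite !in_removable_nbrs.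
rewrite (del_edges_uncovered _ uM) !(del_edges_uncovered _ vM).
rewrite !removableE => /andP[eux rux] /andP[evx _] /andP[evy rvy].
have [xM yM] := andP (mem_cover2 PM).
have [m2 c2] := matching_swap mM PM exy eux evy uv uM vM.
have kT : k < #|T| by case/andP: kM.
set M' := _ |: _ in m2 c2.
have [A [S [B [pt Sk A0 B0 nl]]]] := not_k_connected_sep kT (M_max m2 c2).
have [x0 x0A] := set0Pn _ A0; have [y0 y0B] := set0Pn _ B0.
have cross p q : p \in A -> q \in B -> e p q -> [set p; q] \in M'.
  move=> pA qB epq; apply: contraNT nl => npq; apply/linkedP.
  by exists p, q; split=> //; rewrite /del_edges epq.
(* Deleting [ab] from [J] keeps [A] and [B] linked by an edge outside [M]; that edge is in [M'] and
   differs from [ab], hence is [cd]. *)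
have part2 a b c d : k_connectedb k (del_edges J [set [set a; b]]) ->
    (forall P, P \in M' -> P \notin M -> P = [set a; b] \/ P = [set c; d]) ->
    (c \in A) && (d \in B) || (d \in A) && (c \in B).
  move=> rab hM'.
  have [p [q [pA qB]]] := linkedP _ _ _ (k_connectedb_linked rab pt Sk x0A y0B).
  rewrite /del_edges inE => /andP[/andP[epq pqM] pqab].
  case: (hM' _ (cross _ _ pA qB epq) pqM) => [/eqP|/set2_eq].
    by rewrite (negbTE pqab).
  by case=> -[<- <-]; rewrite pA qB ?orbT.
have hM' P : P \in M' -> P \notin M -> P = [set u; x] \/ P = [set v; y].
  rewrite !inE => /or3P[/eqP ->|/eqP ->|/andP[_ ->] //]; auto.
have cvy := part2 _ _ _ _ rux hM'.
have cux : (u \in A) && (x \in B) || (x \in A) && (u \in B).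
  by apply: part2 rvy _ => P PM' nPM; case: (hM' P PM' nPM); auto.
have ux : u != x by exact: edge_neq.
have nxy : [set x; y] \notin M'.
  rewrite /M' !inE eqxx /= orbF negb_or.
  apply/andP; split; apply/eqP => /setP.
    by move/(_ u); rewrite !inE eqxx (negbTE ux) => /eqP h; rewrite h yM in uM.
  move/(_ v); rewrite !inE eqxx => /orP[]/eqP h; rewrite h ?xM ?yM // in vM.
have nvx : [set v; x] \notin M'.
  rewrite /M' !inE !negb_or !negb_and negbK; apply/and3P; split.
  - by apply/eqP => /setP/(_ u); rewrite !inE eqxx (negbTE uv) (negbTE ux).
  - apply/eqP => /setP/(_ x); rewrite !inE eqxx orbT (negbTE (edge_neq exy)) orbF.
    by move/esym; rewrite eq_sym (negbTE (edge_neq evx)).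
  by apply/orP; right; apply: contra vM => /mem_cover2/andP[].
have dAB z : z \in A -> z \in B -> False.
  by move=> zA zB; have := tripartitionP _ _ _ pt z; rewrite zA zB; case: (z \in S).
case/orP: cux => /andP[uA xB]; case/orP: cvy => /andP[h1 h2].
- by have := cross v x h1 xB evx; rewrite (negbTE nvx).
- by have := cross y x h1 xB; rewrite e_sym setUC (negbTE nxy) => /(_ exy).
- by have := cross x y uA h2 exy; rewrite (negbTE nxy).
by have := cross x v uA h2; rewrite e_sym setUC (negbTE nvx) => /(_ evx).
Qed.

(** Any three of the four incidences between [u], [v] and the ends of [P] match the pattern of
    [no_swap], up to exchanging [u] with [v] or the two ends. *)
Lemma removable_nbrs_edge (u v : T) P : u != v -> u \notin cover M -> v \notin cover M ->
  P \in M -> #|removable_nbrs u :&: P| + #|removable_nbrs v :&: P| <= 2.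
Proof.
move=> uv uM vM PM; case/andP: (mM) => /subsetP/(_ P PM)/edgesP[x [y [exy eP]]] _.
subst P; have xy := edge_neq exy.
have cI A : #|A :&: [set x; y]| = (x \in A) + (y \in A).
  rewrite (cardsD1 x) (cardsD1 y) (_ : _ :\ y = set0) ?cards0.
    by rewrite !inE !eqxx orbT (eq_sym y) xy !andbT addn0.
  by apply/setP => z; rewrite !inE; do !case: eqP; rewrite ?andbF.
have PM' : [set y; x] \in M by rewrite setUC.
have eyx : e y x by rewrite e_sym.
have vu : v != u by rewrite eq_sym.
move: (no_swap PM exy uv uM vM) (no_swap PM exy vu vM uM).
move: (no_swap PM' eyx uv uM vM) (no_swap PM' eyx vu vM uM).
rewrite !cI; move: (x \in removable_nbrs u) (y \in removable_nbrs u).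
move: (x \in removable_nbrs v) (y \in removable_nbrs v); clear.
by do 4!case=> //=; do ?[move=> /(_ isT isT isT) //|move=> _].
Qed.

(** By [uncovered_critical] all removable neighbours of [u] and [v] are covered, so the bound of 2
    per edge of [M] can be summed. *)
Lemma removable_nbrs_leq (u v : T) : u != v -> u \notin cover M -> v \notin cover M ->
  #|removable_nbrs u| + #|removable_nbrs v| <= 2 * #|M|.
Proof.
move=> uv uM vM; have [_ tM] := andP mM.
have sub w : w \notin cover M -> removable_nbrs w \subset cover M.
  move=> wM; apply/subsetP => x; rewrite in_removable_nbrs del_edges_uncovered // => /andP[ewx].
  by apply: contraLR => xM; exact: uncovered_critical.
rewrite !(card_trivIset_setI tM) ?sub // -big_split /= mulnC -sum_nat_const.
by apply: leq_sum => P PM; exact: removable_nbrs_edge.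
Qed.

Lemma degree_uncovered_split u : u \notin cover M ->
  degree e u = #|critical_nbrs u| + #|removable_nbrs u|.
Proof.
move=> uM; rewrite -(degree_uncovered uM) /degree !card_sum_mem -big_split.
apply: eq_bigr => x _ /=.
rewrite in_critical_nbrs in_removable_nbrs inE; case: (J u x) => //=.
by case: (removable u x).
Qed.

Lemma critical_nbrs_geq d (u v : T) : u != v -> u \notin cover M -> v \notin cover M ->
    (forall w, d <= degree e w) ->
  2 * d <= #|critical_nbrs u| + #|critical_nbrs v| + 2 * #|M|.
Proof.
move=> uv uM vM dd; have := removable_nbrs_leq uv uM vM.
have := dd u; have := dd v; rewrite !degree_uncovered_split //; clear; lia.
Qed.

Lemma critical_nbr_sep u x : x \in critical_nbrs u ->
  exists A S B, critical_sep k J u x A S B.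
Proof.
rewrite in_critical_nbrs => /andP[Jux nr].
rewrite removableE in nr.
exact: (nonremovable_critical_sep (del_edges_sym M) kM Jux nr).
Qed.

(** * The case [m <= k]: descent along critical edges *)

Lemma maximal_absurd_large :
    (forall v, k < degree e v) -> (forall v, 2 * #|M|.+1 <= degree e v) ->
    2 * #|M|.+1 <= #|T| -> False.
Proof.
move=> dk dM cT.
have Js := del_edges_sym M; have Ji := del_edges_irr M.
(* At most [2 * #|M|] of the at least [2 * #|M| + 2] neighbours are covered, so an uncovered one
   other than [b] exists. *)
have nbrs v b : v \notin cover M ->
    exists w, [/\ w != b, w \notin cover M & w \in critical_nbrs v].
  move=> vM.
  have : 0 < #|([set w | e v w] :\: cover M) :\ b|.
    have := dM v; rewrite /degree -(cardsID (cover M)).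
    have := subset_leq_card (subsetIr [set w | e v w] (cover M)).
    rewrite card_cover_matching // [X in _ + X](cardsD1 b); clear.
    by case: (_ \in _); lia.
  case/card_gt0P => w; rewrite !inE => /andP[wb /andP[wM evw]].
  exists w; rewrite in_critical_nbrs del_edges_uncovered // evw.
  by rewrite uncovered_critical.
(* The descent: the next edge is [wa] with [w] other than [b], and its side [B'] is smaller than [A]
   by [critical_sep_decr]. *)
have shrink n a b A S B : #|A| < n -> a \notin cover M -> critical_sep k J a b A S B ->
    b \notin cover M -> False.
  elim: n a b A S B => // n IH a b A S B An aM cs bM.
  have [w [wb wM /critical_nbr_sep[A' [S' [B' cs']]]]] := nbrs a b aM.
  have da : k < degree J a by rewrite degree_uncovered.
  have lt : #|B'| < #|A|.
    by apply: (critical_sep_decr Js Ji kM da _ cs cs'); rewrite eq_sym.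
  by apply: (IH w a B' S' A' _ wM (critical_sepC Js cs') aM); apply: leq_trans lt _.
have : 0 < #|~: cover M|.
  by have := cardsC (cover M); rewrite card_cover_matching //; move: cT; clear; lia.
case/card_gt0P => v; rewrite inE => vM.
have [w [_ wM /critical_nbr_sep[A [S [B cs]]]]] := nbrs v v vM.
exact: (shrink _ v w A S B (ltnSn _) vM cs wM).
Qed.

(** * The case [k < m]: sides that span no critical edge *)

Lemma critical_side_geq d a b A S B : critical_sep k J a b A S B ->
  d <= degree J a -> d <= k.-1 + #|A|.
Proof.
move=> cs /leq_trans; apply; have [_ /tripartitionP pt Sk aA bB only] := cs.
(* A neighbour of [a] is [b] or lies in [S] or in [A] minus [a], which allows at most
   [1 + (k - 1) + (#|A| - 1)] of them. *)
have : [set w | J a w] \subset b |: (S :|: (A :\ a)).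
  apply/subsetP => w; rewrite !inE => Jaw.
  have := pt w; have [wB|_] := boolP (w \in B).
    by have [_ ->] := only a w aA wB Jaw; rewrite eqxx.
  have [_|_] := boolP (w \in S); first by rewrite orbT.
  rewrite !addn0; case: (w \in A) => // _; rewrite andbT.
  have /andP[/edge_neq aw _] := Jaw; by rewrite (eq_sym w a) aw !orbT.
move/subset_leq_card/leq_trans; apply.
have := (leq_card_setU S (A :\ a)).1; rewrite cardsU1 (cardsD1 a A) aA.
by move: Sk; clear; case: (_ \notin _); lia.
Qed.

(** Descent to a side spanning no critical edge: a critical edge [wz] inside [A] yields a smaller
    side by [critical_sep_inner]. *)
Lemma tight_side a b A S B :
    (forall v, k < degree J v) ->
    (forall a b A S B, critical_sep k J a b A S B -> k <= #|A|) ->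
    critical_sep k J a b A S B ->
  exists2 A0 : {set T}, A0 \subset A /\ (exists a b S B, critical_sep k J a b A0 S B)
                & forall v, v \in A0 -> #|critical_nbrs v| <= k.
Proof.
move=> dJ big; have Js := del_edges_sym M; have Ji := del_edges_irr M.
have [n] := ubnP #|A|; elim: n a b A S B => // n IH a b A S B An cs.
have [/exists_inP[w wA /exists_inP[z zA zw]]|nin] :=
    boolP [exists w in A, exists z in A, z \in critical_nbrs w].
  have [A' [S' [B' cs']]] := critical_nbr_sep zw.
  suff [p [q [C [N [D [csC sC]]]]]] :
      exists p q C N D, critical_sep k J p q C N D /\ C \proper A.
    have [A0 [sA0 cs0] h] := IH p q C N D (leq_trans (proper_card sC) An) csC.
    by exists A0 => //; split=> //; apply: subset_trans sA0 (proper_sub sC).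
  (* Since [#|S'| < k <= #|B|], the set [B] meets [B'] or [A']; in the latter case the ends of [wz]
     are exchanged. *)
  have kB := big _ _ _ _ _ (critical_sepC Js cs).
  have [x xB xS'] : exists2 x, x \in B & x \notin S'.
    apply/subsetPn; apply: contraTN kB => /subset_leq_card BS.
    by rewrite -ltnNge; apply: leq_ltn_trans BS (cs_small cs').
  have := tripartitionP _ _ _ (cs_part cs') x; rewrite (negbTE xS') addn0.
  have [xB' _|xB' xA'] := boolP (x \in B').
    apply: (critical_sep_inner Js Ji kM (dJ w) cs cs') => //.
    by apply/set0Pn; exists x; rewrite inE xB.
  apply: (critical_sep_inner Js Ji kM (dJ z) cs (critical_sepC Js cs')) => //.
  by apply/set0Pn; exists x; rewrite inE xB; move: xA'; case: (x \in A').
exists A; first by split=> //; exists a, b, S, B.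
move=> v vA; have [_ /tripartitionP pt Sk aA bB only] := cs.
(* All critical edges at [v] leave [A], so they end in [S] or at [b]: at most [(k - 1) + 1]. *)
have : critical_nbrs v \subset b |: S.
  apply/subsetP => z zc; have := pt z; rewrite !inE.
  have [zB|_] := boolP (z \in B).
    have Jvz : J v z by move: zc; rewrite in_critical_nbrs => /andP[].
    by have [_ ->] := only v z vA zB Jvz; rewrite eqxx.
  have [_|_] := boolP (z \in S); first by rewrite orbT.
  rewrite !addn0; case: (boolP (z \in A)) => // zA _.
  by case/exists_inP: nin; exists v => //; apply/exists_inP; exists z.
move/subset_leq_card/leq_trans; apply; rewrite cardsU1; move: Sk; clear.
by case: (_ \notin _); lia.
Qed.

Lemma card_gt1_uncovered m A : #|M| < m -> 2 * m <= #|A| ->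
  exists u v, [/\ u != v, u \in A, v \in A & u \notin cover M /\ v \notin cover M].
Proof.
move=> Mm cA; have : 1 < #|A :\: cover M|.
  have := subset_leq_card (subsetIr A (cover M)); have := cardsID (cover M) A.
  by rewrite card_cover_matching //; move: Mm cA; clear; lia.
case/card_gt1P => u [v []]; rewrite !inE => /andP[uM uA] /andP[vM vA] uv.
by exists u, v.
Qed.

Lemma maximal_absurd_small m : 0 < k -> k < m -> #|M| < m -> 2 * m <= #|T| ->
  (forall v, k + m <= degree e v) -> False.
Proof.
move=> k0 km Mm cT de; have Js := del_edges_sym M.
have dJ v : k + m <= (degree J v).+1 := leq_trans (de v) (degree_del_matching v mM).
(* The degree in [J] is at least [k + m - 1], of which [critical_side_geq] takes off [k - 1]. *)
have side a b A S B : critical_sep k J a b A S B -> m <= #|A|.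
  move=> cs; have := critical_side_geq cs (leqnn _); have := dJ a.
  by move: k0; clear; lia.
have kJ v : k < degree J v by have := dJ v; move: k0 km; clear; lia.
have kside a b A S B : critical_sep k J a b A S B -> k <= #|A|.
  by move=> /side; move: km; clear; lia.
(* The two degrees sum to at least [2 * (k + m)], and at most [2 * (m - 1)] of these incidences are
   removable. *)
have pair u v : u != v -> u \notin cover M -> v \notin cover M ->
    2 * k < #|critical_nbrs u| + #|critical_nbrs v|.
  move=> uv uM vM; have := critical_nbrs_geq uv uM vM de.
  by move: Mm; clear; lia.
have [a [b [A [S [B cs]]]]] : exists a b A S B, critical_sep k J a b A S B.
  rewrite -cardsT in cT.
  have [u [v [uv _ _ [uM vM]]]] := card_gt1_uncovered Mm cT.
  have := pair u v uv uM vM.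
  have [->|[x xu] _] := set_0Vmem (critical_nbrs u).
    have [->|[x xv] _] := set_0Vmem (critical_nbrs v); first by rewrite !cards0.
    by have [A [S [B cs]]] := critical_nbr_sep xv; exists v, x, A, S, B.
  by have [A [S [B cs]]] := critical_nbr_sep xu; exists u, x, A, S, B.
have [A0 [sA0 [? [? [? [? /side cA0]]]]] hA0] := tight_side kJ kside cs.
have [B0 [sB0 [? [? [? [? /side cB0]]]]] hB0] := tight_side kJ kside (critical_sepC Js cs).
(* The two tight sides lie in opposite sides of one separation. *)
have dAB : A0 :&: B0 = set0.
  apply/setP => z; rewrite !inE; apply/negbTE/negP => /andP[/(subsetP sA0) zA /(subsetP sB0) zB].
  by have := tripartitionP _ _ _ (cs_part cs) z; rewrite zA zB; case: (z \in S).
have cAB : 2 * m <= #|A0 :|: B0|.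
  by rewrite cardsU dAB cards0; move: cA0 cB0; clear; lia.
have [u [v [uv uA vA [uM vM]]]] := card_gt1_uncovered Mm cAB.
have hAB w : w \in A0 :|: B0 -> #|critical_nbrs w| <= k.
  by rewrite inE => /orP[/hA0|/hB0].
have := pair u v uv uM vM; have := hAB u uA; have := hAB v vA; clear; lia.
Qed.

End Maximal.
End Matchings.

(** * Building the matching one edge at a time *)

Lemma min_degree_leq (T : finType) (e : rel T) v : min_degree e <= degree e v.
Proof.
rewrite /min_degree; elim: index_enum (mem_index_enum v) => //= w r IH.
rewrite inE big_cons geq_min => /orP[/eqP -> |/IH ->]; first by rewrite leqnn.
by rewrite orbT.
Qed.

Theorem theorem1p7 (k m : nat) (T : finType) (e : rel T)
  (hk : 1 <= k) (hm : 1 <= m)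
  (e_sym : symmetric e) (e_irr : irreflexive e)
  (e_conn : k_connected k e)
  (hcard : 2 * m <= #|T|)
  (hdeg : (if m <= k then maxn (k + uphalf m) (2 * m) else k + m)
            <= min_degree e) :
  exists M : {set {set T}},
    [/\ matching e M, #|M| = m & k_removable k e M].
Proof.
have deg v := leq_trans hdeg (min_degree_leq e v).
(* Induction on the size [i]; the matching of size [i.+1] need not extend the previous one. *)
suff H i : i <= m -> exists M : {set {set T}},
    [/\ matching e M, #|M| = i & k_connectedb k (del_edges e M)].
  by have [M [mM cM kM]] := H m (leqnn m); exists M; split=> //; apply/k_connectedP.
elim: i => [_|i IH im].
  exists set0; rewrite cards0; split=> //.
    rewrite /matching sub0set; apply/trivIsetP => A B; by rewrite inE.
  rewrite (eq_k_connectedb (e2 := e) k); first exact/k_connectedP.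
  by move=> x y; rewrite /del_edges inE andbT.
have [M [mM cM kM]] := IH (ltnW im).
pose good (N : {set {set T}}) :=
  [&& matching e N, #|N| == i.+1 & k_connectedb k (del_edges e N)].
have [/existsP[N /and3P[mN /eqP cN kN]]|/existsPn noN] := boolP [exists N, good N].
  by exists N.
have Mmax N : matching e N -> #|N| = #|M|.+1 -> ~~ k_connectedb k (del_edges e N).
  by move=> mN; rewrite cM => cN; have := noN N; rewrite /good mN cN eqxx.
exfalso; rewrite -cM in im.
case: leqP deg => [mk|km] deg.
  have h : 2 * #|M|.+1 <= 2 * m by rewrite leq_mul2l im orbT.
  apply: (maximal_absurd_large e_sym e_irr mM kM Mmax) => [v|v|].
  (* As [m] is positive, [uphalf m] is at least 1, so every degree exceeds [k]. *)
  - apply: leq_trans (deg v); rewrite leq_max; apply/orP; left.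
    by rewrite -addn1 leq_add2l; case: m hm {deg hcard hdeg IH im mk h} => [|[]].
  - by apply: leq_trans (deg v); rewrite leq_max h orbT.
  exact: leq_trans h hcard.
exact: (maximal_absurd_small e_sym e_irr mM kM Mmax hk km im hcard deg).
Qed.
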